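(* For every integer $x\ge 2$, \[ x! \bmod P_2(x) \;=\; x\left\lfloor \frac{x}{p_{\pi(x)+1}-1}\right\rfloor . \]
   Context: $P_2(x)=\binom{x+1}{2}=\frac{x(x+1)}{2}$ is the $x$th triangular number. $\pi$ is the prime-counting function and $p_k$ is the $k$th prime, so $p_{\pi(x)+1}$ is the smallest prime greater than $x$. For integers $a\ge 0$, $b\ge 1$, $a \bmod b$ denotes the unique remainder $c$ with $0\le c<b$ and $a\equiv c\pmod b$. *)

(* Defs.v *)
(* MathComp; every quantity is in nat. *)
From mathcomp Require Import all_boot.

Set Implicit Arguments.
Unset Strict Implicit.
Unset Printing Implicit Defensive.

Definition P2 (x : nat) : nat := 'C(x.+1, 2).

Definition prime_pi (x : nat) : nat := #|[set p : 'I_x.+1 | prime p]|.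

Lemma ex_prime_gt (n : nat) : exists p, (n < p) && prime p.
Proof. by have [p n_lt_p p_pr] := prime_above n; exists p; rewrite n_lt_p. Qed.

Definition next_prime (n : nat) : nat := ex_minn (ex_prime_gt n).

(* Primes are numbered from 1: [nth_prime 1] is 2, [nth_prime 2] is 3, and so
   on; [nth_prime 0 = 0] is a junk value. *)
Definition nth_prime (k : nat) : nat := iter k next_prime 0.

(* Main.v *)
(** By induction on [x], the prime numbered [pi(x) + 1] is the least prime above [x]; so the
    quotient on the right is 1 or 0 according to whether [x + 1] is prime.
    If it is, [x] is even and Wilson's theorem gives [x! = -1 = x] modulo [x + 1],
    while [x! = 0 = x] modulo [x / 2], which is coprime to [x + 1].
    Otherwise [x (x + 1) / 2] divides [x!]. *)
Require Import Defs.
From mathcomp Require Import all_boot.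
From mathcomp Require Import zify.

Lemma prime_piS (x : nat) : prime_pi x.+1 = prime_pi x + prime x.+1.
Proof.
have piE n : prime_pi n = \sum_(p < n.+1) prime p.
  by rewrite /prime_pi cardsE -sum1_card big_mkcond.
by rewrite !piE big_ord_recr.
Qed.

Lemma next_prime_unique (n p : nat) :
  n < p -> prime p -> (forall q, n < q -> prime q -> p <= q) -> next_prime n = p.
Proof.
move=> n_lt_p p_pr p_min; rewrite /next_prime.
case: ex_minnP => m /andP[n_lt_m m_pr] m_min.
by apply/eqP; rewrite eqn_leq p_min // m_min // n_lt_p.
Qed.

Lemma next_prime_of_primeS (n : nat) : prime n.+1 -> next_prime n = n.+1.
Proof. by move=> n1_pr; apply: next_prime_unique. Qed.

Lemma next_prime_of_compositeS (n : nat) :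
  ~~ prime n.+1 -> next_prime n = next_prime n.+1.
Proof.
move=> n1_npr; rewrite [RHS]/next_prime.
case: ex_minnP => m /andP[n1_lt_m m_pr] m_min.
apply: next_prime_unique => // [|q n_lt_q q_pr]; first exact: ltnW.
apply: m_min; rewrite q_pr ltn_neqAle n_lt_q !andbT.
by apply: contraNneq n1_npr => ->.
Qed.

(** If [x + 1] is prime, it is [next_prime x], and the increment of [prime_pi] is one more iteration
    of [next_prime]; otherwise neither side changes. *)
Lemma nth_prime_pi (x : nat) : nth_prime (prime_pi x).+1 = next_prime x.
Proof.
elim: x => [|x IHx].
  by have -> : prime_pi 0 = 0 by apply: eq_card0 => p; rewrite inE ord1.
rewrite prime_piS; case: (boolP (prime x.+1)) => [x1_pr | x1_npr].
  rewrite addn1 -[LHS]/(next_prime (nth_prime (prime_pi x).+1)) IHx.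
  by rewrite (next_prime_of_primeS _ x1_pr).
by rewrite addn0 IHx next_prime_of_compositeS.
Qed.

(** In [n! = 'C(n, a) * (a! * (n - a)!)], [a] divides [a!] and [b] divides [(n - a)!] since
    [b <= n - a]. *)
Lemma dvdn_mul_fact (a b n : nat) :
  0 < a -> 0 < b -> a + b <= n -> a * b %| n`!.
Proof.
move=> a_gt0 b_gt0 ab_le_n.
have a_le_n : a <= n by lia.
by rewrite -(bin_fact a_le_n) dvdn_mull // dvdn_mul // dvdn_fact; lia.
Qed.

(** Both factors in [n = e * d] are odd, hence at least 3, so [e + d <= n - 1]. This needs no
    separate case for [e = d]. *)
Lemma dvdn_fact_odd_composite (n : nat) :
  1 < n -> odd n -> ~~ prime n -> n %| n.-1`!.
Proof.
move=> n_gt1 n_odd /primePn[|[d /andP[d_gt1 d_lt_n]]]; first by lia.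
move=> /dvdnP[e n_eq]; move: n_odd; rewrite n_eq oddM => /andP[e_odd d_odd].
have e_gt2 : 2 < e by case: e e_odd n_eq => [|[|[|e]]] //; lia.
have d_gt2 : 2 < d by case: d d_odd d_gt1 {d_lt_n n_eq} => [|[|[|d]]].
have ed_lt : e + d < e * d by rewrite {n_eq e_odd d_odd d_lt_n}; nia.
by apply: dvdn_mul_fact; lia.
Qed.

Lemma P2_odd (x : nat) : odd x -> P2 x = x * x.+1./2.
Proof.
move=> x_odd; have x1_eq : x.+1 = x.+1./2.*2 by lia.
by rewrite /P2 bin2 {1}x1_eq -doubleMl doubleK mulnC.
Qed.

Lemma P2_even (x : nat) : ~~ odd x -> P2 x = x./2 * x.+1.
Proof.
move=> x_even; have x_eq : x = x./2.*2 by lia.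
by rewrite /P2 bin2 [_.+1.-1]x_eq -doubleMr doubleK mulnC.
Qed.

Lemma coprime_half_even_succ (x : nat) : ~~ odd x -> coprime x./2 x.+1.
Proof.
move=> x_even; have -> : x.+1 = 2 * x./2 + 1 by lia.
by rewrite /coprime gcdnMDl gcdn1.
Qed.

Lemma P2_dvd_fact (x : nat) : 2 <= x -> ~~ prime x.+1 -> P2 x %| x`!.
Proof.
case: x => // n n_gt0 x1_npr; set x := n.+1 in x1_npr *.
case: (boolP (odd x)) => [x_odd | x_even].
  (* Split [x! = x * (x - 1)!]; as [x >= 3], [(x + 1) / 2 <= x - 1]. *)
  rewrite P2_odd // factS dvdn_mul // dvdn_fact //.
  by rewrite /x in x_odd *; lia.
(* The coprime factors are treated separately; [x + 1] is odd and composite. *)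
rewrite P2_even // Gauss_dvd ?coprime_half_even_succ //.
rewrite dvdn_fact; last by rewrite /x in x_even *; lia.
exact: (@dvdn_fact_odd_composite x.+1).
Qed.

Lemma fact_mod_P2_prime (x : nat) : 2 <= x -> prime x.+1 -> x`! = x %[mod P2 x].
Proof.
move=> x_ge2 x1_pr.
have x_even : ~~ odd x by case/even_prime: x1_pr => /=; lia.
apply/eqP; rewrite P2_even // chinese_remainder ?coprime_half_even_succ //.
apply/andP; split.
  have x_half : x./2 %| x by apply/dvdnP; exists 2; lia.
  rewrite (eqP (dvdn_trans x_half _)) ?(eqP x_half) //.
  by apply: dvdn_fact; lia.
have : x.+1 %| (x`!).+1 by rewrite -(@Wilson x.+1) // ltnS ltnW.
(* Adding 1 to both sides turns the goal into [x! + 1 = 0] modulo [x + 1]. *)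
by rewrite -(eqn_modDr 1) !addn1 modnn.
Qed.

Theorem theorem7p4 (x : nat) (hx : 2 <= x) :
  x`! %% P2 x = x * (x %/ (nth_prime (prime_pi x).+1 - 1)).
Proof.
rewrite nth_prime_pi; case: (boolP (prime x.+1)) => [x1_pr | x1_npr].
  rewrite next_prime_of_primeS // subn1 divnn fact_mod_P2_prime //.
  (* The remainder is [x] itself, since [x < (x / 2) * (x + 1)] when [x / 2 >= 1]. *)
  rewrite (ltnW hx) muln1 modn_small // P2_even; first by nia.
  by case/even_prime: x1_pr => /=; lia.
rewrite (eqP (P2_dvd_fact _ hx x1_npr)) next_prime_of_compositeS //.
(* The next prime [m] exceeds [x + 1], so [m - 1 > x] and the quotient is 0. *)
rewrite /next_prime; case: ex_minnP => m /andP[m_gt _] _.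
by rewrite divn_small ?muln0; lia.
Qed.
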